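(* Let $X,Y$ be real normed vector spaces, $K\subseteq X$ a convex cone, $A:X\to Y$ a continuous linear operator, $b\in Y$, $c\in X^*$, where $Y$ and $Y^*$ are normed vector lattices. Consider the primal problem: minimize $\langle c,x\rangle$ subject to $Ax=b$, $x\in K$, with optimal value $\hat f_p$, and the dual problem: maximize $\langle y,b\rangle$ subject to $-A^*y+c\in K^*$, $y\in Y^*$, with optimal value $\hat f_d$. Assume that the dual boundedness qualification (DBQ) holds with bound $\overline{y}\in Y^*$. Let $\tilde x\in X$, and suppose that $\overline{r}\in Y$, $\underline{x}^-\in X$ and $\overline{d}\in X^*$ satisfy $$|A\tilde x-b|\le\overline{r},\qquad \underline{x}^-\le\tilde x,\quad \underline{x}^-\le 0,$$ $$\overline{d}\ \ge\ -A^*y+c\quad\text{for all dual feasible } y \text{ with } |y|\le\overline{y}.$$ Then: (a) The dual optimal value is bounded from above by $$\hat f_d\ \le\ \langle c,\tilde x\rangle-\langle\overline{d},\underline{x}^-\rangle+\langle\overline{y},\overline{r}\rangle=:\overline{f}_d.$$ (b) If $\underline{x}^-=0$ and $\overline{r}=0$, then $\tilde x$ is primal feasible and $\hat f_p\le\overline{f}_d=\langle c,\tilde x\rangle$; if moreover $\tilde x$ is primal optimal, then $\hat f_p=\overline{f}_d$.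
   Context: A convex cone $K\subseteq X$ satisfies $K+K\subseteq K$ and $\alpha K\subseteq K$ for all real $\alpha\ge 0$ (and contains $0$); it induces the reflexive and transitive relation $x\le y:\Leftrightarrow y-x\in K$ on $X$ (antisymmetry is not assumed for $X$). $X^*$ is the space of continuous linear functionals on $X$, $\langle y,x\rangle:=y(x)$, $K^*=\{y\in X^*:\langle y,x\rangle\ge0\ \forall x\in K\}$, and $X^*$ is ordered by $K^*$. $A^*:Y^*\to X^*$ is the adjoint of $A$. $\hat f_p$ is the infimum of the primal objective over the feasible set ($+\infty$ if infeasible); $\hat f_d$ is the supremum of the dual objective over the dual feasible set ($-\infty$ if infeasible). A normed vector lattice is a real normed space with a partial ordering induced by a convex cone in which $\sup\{u,v\}$ and $\inf\{u,v\}$ exist for all $u,v$; one sets $|u|:=\sup\{u,-u\}$, and $|u|=0$ iff $u=0$ (the ordering is antisymmetric). $Y^*$ is ordered by the cone of positive continuous linear functionals on $Y$. DBQ (with bound $\overline{y}\in Y^*$): either (i) the dual problem is infeasible (in which case no condition is imposed on $\overline{y}$), or (ii) $\hat f_d$ is finite and for every $\varepsilon>0$ there exists a dual feasible $y(\varepsilon)$ with $|y(\varepsilon)|\le\overline{y}$ and $\hat f_d-\langle y(\varepsilon),b\rangle\le\varepsilon$. *)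

(* Defs.v *)
From HB Require Import structures.
From mathcomp Require Import all_boot all_order all_algebra.
From mathcomp Require Import all_classical all_reals.
From mathcomp Require Import ereal topology normedtype.

Set Implicit Arguments.
Unset Strict Implicit.
Unset Printing Implicit Defensive.

Import Order.TTheory GRing.Theory Num.Theory.
Import numFieldNormedType.Exports.
Local Open Scope classical_set_scope.
Local Open Scope ring_scope.

(* The library has no type of continuous linear functionals: it is built here
   as a submodule of [V -> R^o], normed by the operator norm. *)
Section ContinuousDual.
Context {R : realType} {V : normedModType R}.

Definition continuous_linear : {pred V -> R^o} :=
  mem [set f : V -> R^o | linear f /\ continuous f].

Lemma continuous_linearP (f : V -> R^o) :
  f \in continuous_linear <-> linear f /\ continuous f.
Proof. by split=> [/set_mem|/mem_set]. Qed.

Lemma continuous_linear_submod : submod_closed continuous_linear.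
Proof.
split=> [|a f g /continuous_linearP[lf cf] /continuous_linearP[lg cg]];
    apply/continuous_linearP; split.
- by move=> a x y; rewrite [RHS](_ : _ = a *: (0 : R^o) + 0)// scaler0 addr0.
- by move=> x; exact: (@cst_continuous V R^o 0).
- move=> b x y; rewrite -[LHS]/(a *: f (b *: x + y) + g (b *: x + y)) lf lg.
  rewrite -[RHS]/(b *: (a *: f x + g x) + (a *: f y + g y)) !scalerDr !scalerA.
  by rewrite (mulrC a b) addrACA.
- move=> x; apply: (@cvgD R R^o); last exact: cg.
  by apply: (@cvgZl_tmp R R^o); exact: cf.
Qed.

HB.instance Definition _ :=
  GRing.isSubmodClosed.Build R (V -> R^o) continuous_linear
    continuous_linear_submod.

End ContinuousDual.

Record dual {R : realType} (V : normedModType R) := Dual {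
  dual_fun : V -> R^o ;
  dual_fun_in : dual_fun \in continuous_linear }.

Definition pairing {R : realType} {V : normedModType R} (y : dual V) (x : V)
  : R := dual_fun y x.
#[global] Arguments pairing : simpl never.

Notation "⟨ y , x ⟩" := (pairing y x)
  (at level 0, y at level 200, x at level 200, format "⟨ y ,  x ⟩")
  : ring_scope.

Section DualModule.
Context {R : realType} {V : normedModType R}.

HB.instance Definition _ := [isSub for @dual_fun R V].
HB.instance Definition _ := [Choice of dual V by <:].
HB.instance Definition _ := [SubChoice_isSubLmodule of dual V by <:].

Lemma dual_ext (y z : dual V) : (forall x, ⟨y, x⟩ = ⟨z, x⟩) -> y = z.
Proof. by move=> yz; apply/val_inj/funext. Qed.

Lemma pairing_continuous (y : dual V) : continuous (pairing y).
Proof. by have /continuous_linearP[] := dual_fun_in y. Qed.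

Lemma pairing_linear (y : dual V) a u v :
  ⟨y, a *: u + v⟩ = a * ⟨y, u⟩ + ⟨y, v⟩.
Proof. by have /continuous_linearP[+ _] := dual_fun_in y; apply. Qed.

Lemma pairingDl (y z : dual V) x : ⟨y + z, x⟩ = ⟨y, x⟩ + ⟨z, x⟩.
Proof. by []. Qed.

Lemma pairingNl (y : dual V) x : ⟨- y, x⟩ = - ⟨y, x⟩.
Proof. by []. Qed.

Lemma pairingZl a (y : dual V) x : ⟨a *: y, x⟩ = a * ⟨y, x⟩.
Proof. by []. Qed.

Lemma pairing0l x : ⟨0 : dual V, x⟩ = 0.
Proof. by []. Qed.

Lemma pairingDr (y : dual V) u v : ⟨y, u + v⟩ = ⟨y, u⟩ + ⟨y, v⟩.
Proof. by have := pairing_linear y 1 u v; rewrite scale1r mul1r. Qed.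

Lemma pairing0r (y : dual V) : ⟨y, 0⟩ = 0.
Proof. by apply: (@addIr _ ⟨y, 0⟩); rewrite -pairingDr !add0r. Qed.

Lemma pairingZr (y : dual V) a u : ⟨y, a *: u⟩ = a * ⟨y, u⟩.
Proof. by have := pairing_linear y a u 0; rewrite !addr0 pairing0r addr0. Qed.

Definition op_norm (y : dual V) : R :=
  sup [set `|⟨y, x⟩| | x in [set x : V | `|x| <= 1]].

Lemma has_sup_op_norm (y : dual V) :
  has_sup [set `|⟨y, x⟩| | x in [set x : V | `|x| <= 1]].
Proof.
split; first by exists `|⟨y, 0⟩|; exists 0; rewrite //= normr0.
have /continuous_linearP[ly cy] := dual_fun_in y.
pose l := GRing.isLinear.Build R V R^o *:%R (dual_fun y) ly.
pose f : {linear V -> R^o} := HB.pack (dual_fun y) l.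
have /bounded_funP/(_ 1)[M hM] : bounded_near f (nbhs (0 : V)).
  by apply: continuous_linear_bounded; exact: cy.
by exists M => _ [x /= x1 <-]; exact: hM.
Qed.

Lemma op_norm_ub (y : dual V) x : `|x| <= 1 -> `|⟨y, x⟩| <= op_norm y.
Proof.
by move=> x1; apply: ub_le_sup; [case: (has_sup_op_norm y) | exists x].
Qed.

Lemma op_norm_le (y : dual V) M :
  (forall x, `|x| <= 1 -> `|⟨y, x⟩| <= M) -> op_norm y <= M.
Proof.
move=> yM; apply: ge_sup; first by case: (has_sup_op_norm y).
by move=> _ [x /= x1 <-]; exact: yM.
Qed.

Lemma op_normD (y z : dual V) : op_norm (y + z) <= op_norm y + op_norm z.
Proof.
apply: op_norm_le => x x1; rewrite pairingDl (le_trans (ler_normD _ _))//.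
by rewrite lerD// op_norm_ub.
Qed.

Lemma op_normZ a (y : dual V) : op_norm (a *: y) = `|a| * op_norm y.
Proof.
have le_opZ b z : op_norm (b *: z) <= `|b| * op_norm z.
  by apply: op_norm_le => x x1; rewrite pairingZl normrM ler_wpM2l// op_norm_ub.
apply/eqP; rewrite eq_le le_opZ/=.
have [->|a0] := eqVneq a 0.
  rewrite normr0 mul0r (le_trans (normr_ge0 ⟨0 *: y, 0⟩))// op_norm_ub//.
  by rewrite normr0.
rewrite -ler_pdivlMl ?normr_gt0// -normfV.
by rewrite (le_trans _ (le_opZ a^-1 _))// scalerA mulVf// scale1r.
Qed.

Lemma op_norm0_eq0 (y : dual V) : op_norm y = 0 -> y = 0.
Proof.
move=> y0; apply: dual_ext => x; rewrite pairing0l.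
have [->|x0] := eqVneq x 0; first exact: pairing0r.
have nx0 : `|x| != 0 by rewrite normr_eq0.
have : `|⟨y, `|x|^-1 *: x⟩| <= 0.
  by rewrite -y0 op_norm_ub// normrZ normfV normr_id mulVf.
rewrite normr_le0 pairingZr mulf_eq0 invr_eq0 (negbTE nx0)/=.
by move/eqP.
Qed.

HB.instance Definition _ :=
  Lmodule_isNormed.Build R (dual V) op_normD op_normZ op_norm0_eq0.

End DualModule.

Section Adjoint.
Context {R : realType} {X Y : normedModType R}.
Variables (A : {linear X -> Y}) (contA : continuous A).

Lemma adjoint_subproof (y : dual Y) :
  (fun x => dual_fun y (A x)) \in (continuous_linear : {pred X -> R^o}).
Proof.
have /continuous_linearP[ly cy] := dual_fun_in y.
apply/continuous_linearP; split=> [a u v|x]; first by rewrite linearP ly.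
by apply: (@continuous_comp _ _ _ A (dual_fun y)); [exact: contA|exact: cy].
Qed.

Definition adjoint (y : dual Y) : dual X := Dual (adjoint_subproof y).

Lemma adjointE (y : dual Y) x : ⟨adjoint y, x⟩ = ⟨y, A x⟩.
Proof. by []. Qed.

End Adjoint.

Section ConeOrder.
Context {R : realType} {V : normedModType R}.

Record convex_cone (K : set V) : Prop := ConvexCone {
  cone0 : K 0 ;
  coneD : forall u v, K u -> K v -> K (u + v) ;
  coneZ : forall (a : R) u, 0 <= a -> K u -> K (a *: u) }.

Definition cone_le (K : set V) (u v : V) : Prop := K (v - u).

Definition is_sup2 (K : set V) (u v s : V) : Prop :=
  [/\ cone_le K u s, cone_le K v s &
      forall t, cone_le K u t -> cone_le K v t -> cone_le K s t].

Definition is_inf2 (K : set V) (u v s : V) : Prop :=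
  [/\ cone_le K s u, cone_le K s v &
      forall t, cone_le K t u -> cone_le K t v -> cone_le K t s].

(* No compatibility between the norm and the order is required. *)
Record normed_vector_lattice (K : set V) : Prop := NormedVectorLattice {
  lattice_cone : convex_cone K ;
  lattice_anti : forall u v, cone_le K u v -> cone_le K v u -> u = v ;
  lattice_sup : forall u v, exists s, is_sup2 K u v s ;
  lattice_inf : forall u v, exists s, is_inf2 K u v s }.

(* [|u| = sup {u, -u}]; the default value 0 is never used when [V] is a vector
   lattice, where this supremum exists and is unique. *)
Definition cone_abs (K : set V) (u : V) : V := xget 0 (is_sup2 K u (- u)).

Definition dual_cone (K : set V) : set (dual V) :=
  [set y | forall x, K x -> 0 <= ⟨y, x⟩].

End ConeOrder.

Section ConicProgram.
Context {R : realType} {X Y : normedModType R}.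
Variables (K : set X) (A : {linear X -> Y}) (contA : continuous A).
Variables (b : Y) (c : dual X).

Definition primal_feasible : set X := [set x | A x = b /\ K x].

Definition primal_value : \bar R :=
  ereal_inf [set ⟨c, x⟩%:E | x in primal_feasible].

Definition primal_optimal (x : X) : Prop :=
  primal_feasible x /\ forall z, primal_feasible z -> ⟨c, x⟩ <= ⟨c, z⟩.

Definition dual_feasible : set (dual Y) :=
  [set y | dual_cone K (- adjoint contA y + c)].

Definition dual_value : \bar R :=
  ereal_sup [set ⟨y, b⟩%:E | y in dual_feasible].

(* [C] is the positive cone of [Y]. *)
Definition DBQ (C : set Y) (ybar : dual Y) : Prop :=
  dual_feasible = set0 \/
  (dual_value \is a fin_num /\
   forall eps : R, 0 < eps ->
     exists y, [/\ dual_feasible y,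
                   cone_le (dual_cone C) (cone_abs (dual_cone C) y) ybar &
                   (dual_value - ⟨y, b⟩%:E <= eps%:E)%E]).

End ConicProgram.

(* Main.v *)
Require Import Defs.
From mathcomp Require Import all_boot all_order all_algebra.
From mathcomp Require Import all_classical all_reals.
From mathcomp Require Import ereal topology normedtype.
From mathcomp Require Import lra.
Import Order.TTheory GRing.Theory Num.Theory.
Import numFieldNormedType.Exports.
Local Open Scope classical_set_scope.
Local Open Scope ring_scope.

(** Weak duality survives an inexact primal point, provided that its defects are
    paid for.  For a dual feasible [y] with slack [d := c - A^* y],
      [⟨y, b⟩ = ⟨c, xt⟩ - ⟨d, xt⟩ - ⟨y, A xt - b⟩].
    The violation of [xt ∈ K] is at most [xm]: since [d] is positive and
    [xm <= xt], [⟨d, xt⟩ >= ⟨d, xm⟩], and [xm <= 0] turns the upper bound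
    [d <= dbar] into [⟨d, xm⟩ >= ⟨dbar, xm⟩] ([slack_pairing_ge]).  The violation
    of [A xt = b] costs at most [⟨ybar, rbar⟩], because a pairing is controlled
    by bounds on the absolute values of its two arguments ([pairing_abs_bound]).
    This bounds [⟨y, b⟩] for those [y] that satisfy [|y| <= ybar]
    ([dual_objective_le]); the qualification says precisely that such [y] already
    approach the dual optimal value, which gives (a).

    For (b), [|A xt - b| <= 0] forces [A xt = b] by antisymmetry of the order of
    [Y], and [0 <= xt] is membership in [K]; so [xt] is feasible and both
    correction terms vanish. *)

(** A bound on [|u|] is only ever used through the two one-sided bounds that it
    implies, stated as memberships in the cone. *)
Lemma cone_abs_le_sides {R : realType} {V : normedModType R} {K : set V}
    {u v : V} :
  normed_vector_lattice K -> cone_le K (cone_abs K u) v ->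
  K (v - u) /\ K (v + u).
Proof.
move=> latK le_uv; have cK := lattice_cone latK.
have [le_u le_Nu _] : is_sup2 K u (- u) (cone_abs K u).
  by apply: xgetPex; exact: (lattice_sup latK).
split.
- by have := coneD cK le_uv le_u; rewrite addrA subrK.
- by have := coneD cK le_uv le_Nu; rewrite addrA subrK opprK.
Qed.

Lemma pairingBr {R : realType} {V : normedModType R} (y : dual V) (u v : V) :
  ⟨y, u - v⟩ = ⟨y, u⟩ - ⟨y, v⟩.
Proof. by rewrite pairingDr -scaleN1r pairingZr mulN1r. Qed.

(** The duality inequality [|⟨y, u⟩| <= ⟨|y|, |u|⟩], for arbitrary bounds [z] of
    [|y|] and [v] of [|u|]; replacing [y] by [- y] gives the other sign.  It
    holds because
      [2 (⟨z, v⟩ + ⟨y, u⟩) = ⟨z + y, v + u⟩ + ⟨z - y, v - u⟩]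
    and both terms on the right are nonnegative. *)
Lemma pairing_abs_bound {R : realType} {V : normedModType R} {C : set V}
    {y z : dual V} {u v : V} :
  dual_cone C (z - y) -> dual_cone C (z + y) -> C (v - u) -> C (v + u) ->
  - ⟨y, u⟩ <= ⟨z, v⟩.
Proof.
move=> zBy zDy vBu vDu.
have := zBy _ vBu; have := zDy _ vDu.
rewrite !pairingDl !pairingNl !pairingBr !pairingDr.
lra.
Qed.

(** Replacing [x] by its lower bound [m] uses that [d] is positive; replacing [d]
    by its upper bound [e] reverses direction because [m] is nonpositive. *)
Lemma slack_pairing_ge {R : realType} {V : normedModType R} {K : set V}
    {d e : dual V} {x m : V} :
  dual_cone K d -> cone_le (dual_cone K) d e ->
  cone_le K m x -> cone_le K m 0 -> ⟨e, m⟩ <= ⟨d, x⟩.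
Proof.
move=> d0 de mx m0.
have := d0 _ mx; have := de _ m0.
rewrite !pairingDl !pairingNl !pairingBr !pairing0r.
lra.
Qed.

Lemma dual_objective_le {R : realType} {X Y : normedModType R}
    {K : set X} {C : set Y} {A : {linear X -> Y}} {contA : continuous A}
    {b : Y} {c : dual X} {y ybar : dual Y} {xt xm : X} {rbar : Y}
    {dbar : dual X} :
  normed_vector_lattice C -> normed_vector_lattice (dual_cone C) ->
  dual_feasible K contA c y ->
  cone_le (dual_cone C) (cone_abs (dual_cone C) y) ybar ->
  cone_le C (cone_abs C (A xt - b)) rbar ->
  cone_le K xm xt -> cone_le K xm 0 ->
  cone_le (dual_cone K) (- adjoint contA y + c) dbar ->
  ⟨y, b⟩ <= ⟨c, xt⟩ - ⟨dbar, xm⟩ + ⟨ybar, rbar⟩.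
Proof.
move=> latY latYdual feas_y le_y le_r le_xt le_x0 le_d.
have [yB yD] := cone_abs_le_sides latYdual le_y.
have [rB rD] := cone_abs_le_sides latY le_r.
have := pairing_abs_bound yB yD rB rD.
have := slack_pairing_ge feas_y le_d le_xt le_x0.
rewrite pairingBr pairingDl pairingNl adjointE.
lra.
Qed.

Theorem theorem4p2 (R : realType) (X Y : normedModType R)
  (K : set X) (C : set Y)
  (A : {linear X -> Y}) (contA : continuous A) (b : Y) (c : dual X)
  (convK : convex_cone K)
  (latY : normed_vector_lattice C)
  (latYdual : normed_vector_lattice (dual_cone C))
  (ybar : dual Y) (dbq : DBQ K contA b c C ybar)
  (xt : X) (rbar : Y) (xm : X) (dbar : dual X)
  (hr : cone_le C (cone_abs C (A xt - b)) rbar)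
  (hxt : cone_le K xm xt) (hx0 : cone_le K xm 0)
  (hd : forall y : dual Y, dual_feasible K contA c y ->
          cone_le (dual_cone C) (cone_abs (dual_cone C) y) ybar ->
          cone_le (dual_cone K) (- adjoint contA y + c) dbar) :
  let fd_bar : R := ⟨c, xt⟩ - ⟨dbar, xm⟩ + ⟨ybar, rbar⟩ in
  (dual_value K contA b c <= fd_bar%:E)%E /\
  (xm = 0 -> rbar = 0 ->
     [/\ primal_feasible K A b xt,
         (primal_value K A b c <= fd_bar%:E)%E,
         fd_bar = ⟨c, xt⟩ &
         primal_optimal K A b c xt -> primal_value K A b c = fd_bar%:E]).
Proof.
move=> fd_bar; split.
  case: dbq => [infeas|[fin approx]].
    by rewrite /dual_value infeas image_set0 ereal_sup0 leNye.
  apply/lee_addgt0Pr => eps eps0.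
  have [y [feas_y le_y]] := approx _ eps0.
  rewrite leeBlDr// => /le_trans; apply.
  rewrite addeC leeD2r// lee_fin.
  exact: dual_objective_le feas_y le_y hr hxt hx0 (hd _ feas_y le_y).
move=> xm0 rbar0.
have feas_xt : primal_feasible K A b xt.
  split; last by move: hxt; rewrite /cone_le xm0 subr0.
  move: hr; rewrite rbar0 => /(cone_abs_le_sides latY)[le_r ge_r].
  apply/subr0_eq/(lattice_anti latY) => //.
  by rewrite /cone_le subr0 -[X in C X]add0r.
have fdE : fd_bar = ⟨c, xt⟩.
  by rewrite /fd_bar xm0 rbar0 !pairing0r subr0 addr0.
have value_le : (primal_value K A b c <= fd_bar%:E)%E.
  by rewrite fdE; apply: ereal_inf_lbound; exists xt.
split=> // -[_ opt_xt]; apply/eqP; rewrite eq_le value_le fdE/=.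
by apply: le_ereal_inf_tmp => _ [z feas_z <-]; rewrite lee_fin opt_xt.
Qed.
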